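(* Let $k\ge2$. For an integer $Z\ge1$ let $E_{k,Z}$ be the number of integers $t$ with $1\le t<2^k-1$, $|S_{t,k}|=2^{k-1}$, and whose $k$-bit word has exactly $Z$ zeros; let $E_k$ be the total number of integers $t$ with $1\le t<2^k-1$ and $|S_{t,k}|=2^{k-1}$. If $1\le Z\le\lfloor\sqrt k\rfloor$, then $$E_{k,Z}=\frac{k}{Z}\binom{k-Z^2+Z-1}{Z-1}.$$ For $Z>\sqrt k$ one has $E_{k,Z}=0$. Hence $$E_k=\sum_{1\le Z\le\lfloor\sqrt k\rfloor}\frac{k}{Z}\binom{k-Z^2+Z-1}{Z-1}.$$
   Context: For an integer $n\ge0$, $\operatorname{wt}(n)$ is the number of ones in its binary expansion. For $k\ge2$, $N=2^k-1$ and $1\le t\le N-1$, $$S_{t,k}=\{(a,b)\in\{0,\ldots,N-1\}^2: a+b\equiv t \pmod N,\ \operatorname{wt}(a)+\operatorname{wt}(b)<k\}.$$ The $k$-bit word of $t$ is its binary expansion padded with zeros to length $k$. *)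

(* Defs.v *)
From mathcomp Require Import all_boot all_order all_algebra.
Set Implicit Arguments.
Unset Strict Implicit.
Unset Printing Implicit Defensive.

Definition bit (n i : nat) : bool := odd (n %/ 2 ^ i).

(* The bound i < n loses no digit, because n < 2 ^ n. *)
Definition wt (n : nat) : nat := \sum_(i < n) bit n i.

(* Least significant bit first. *)
Definition word (k t : nat) : k.-tuple bool := [tuple bit t i | i < k].

Definition zeros (k t : nat) : nat := count_mem false (word k t).

Definition Stk (t k : nat) : {set 'I_(2 ^ k - 1) * 'I_(2 ^ k - 1)} :=
  [set ab : 'I_(2 ^ k - 1) * 'I_(2 ^ k - 1) |
    (ab.1 + ab.2 == t %[mod 2 ^ k - 1]) && (wt ab.1 + wt ab.2 < k)].

Definition extremal (k : nat) : {set 'I_(2 ^ k - 1)} :=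
  [set t : 'I_(2 ^ k - 1) | (1 <= t) && (#|Stk t k| == 2 ^ (k - 1))].

Definition E (k : nat) : nat := #|extremal k|.

Definition EZ (k Z : nat) : nat := #|[set t in extremal k | zeros k t == Z]|.

(* Main.v *)
(** Read the k-bit word of t and the words of a and b from the least significant
    bit, so that a + b = t modulo 2 ^ k - 1 becomes an addition with a cyclic
    carry. A transfer matrix over {0, 1} (the carry) shows that |S_{t,k}| is the
    sum of the first k coefficients of its trace, which is invariant under
    rotation of the word; one may thus assume that the word is 0q. For such a
    word the trace equals
      (2X)^k + X^(2 #1(q)) + (1 - X)^2 D(q),
    with D(q) the generating function of a family of words lying below q. Hence
    2 |S_{t,k}| is 2^k plus a correction that is controlled by the differences
    2 e_n - e_(n+1) for n odd, where e_n counts the words of length n of the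
    family with n/2 (rounded down) ones. Counting the insertions of a one in two
    ways gives e_(n+1) <= 2 e_n, and the correction vanishes exactly when every
    maximal block of ones delimited by the zeros of 0q has length at least
    Z - 1, with Z the number of zeros. These words are counted up to rotation. *)
From Stdlib Require PeanoNat.
Require Import Defs.
From mathcomp Require Import all_boot all_order all_algebra.
From mathcomp Require Import zify ring.
Set Implicit Arguments.
Unset Strict Implicit.
Unset Printing Implicit Defensive.
Import Order.TTheory GRing.Theory Num.Theory.
Local Open Scope ring_scope.

(** * Sums over the binary words of a given length *)

Fixpoint wsum (V : nmodType) (n : nat) (F : seq bool -> V) : V :=
  if n is n'.+1 then
    wsum n' (fun u => F (true :: u)) + wsum n' (fun u => F (false :: u))
  else F [::].

Lemma eq_wsum (V : nmodType) n (F G : seq bool -> V) :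
  (forall u, size u = n -> F u = G u) -> wsum n F = wsum n G.
Proof.
elim: n F G => [|n IHn] F G FG /=; first exact: FG.
by congr (_ + _); apply: IHn => u su; apply: FG; rewrite /= su.
Qed.

Lemma raddf_wsum (V W : nmodType) (f : {additive V -> W}) n (F : seq bool -> V) :
  f (wsum n F) = wsum n (fun u => f (F u)).
Proof. by elim: n F => [|n IHn] F //=; rewrite raddfD !IHn. Qed.

Lemma wsum0 (V : nmodType) n : wsum n (fun=> 0 : V) = 0.
Proof. by elim: n => [|n IHn] //=; rewrite IHn addr0. Qed.

Lemma wsum_sum n m (F : 'I_m -> seq bool -> nat) :
  (\sum_(j < m) wsum n (F j))%N = wsum n (fun u => \sum_(j < m) F j u)%N.
Proof.
elim: n F => [|n IHn] F //=.
by rewrite big_split /= !IHn.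
Qed.

Lemma wsum_rcons (V : nmodType) n (F : seq bool -> V) :
  wsum n.+1 F =
    wsum n (fun u => F (rcons u true)) + wsum n (fun u => F (rcons u false)).
Proof.
elim: n F => [|n IHn] F //.
rewrite [LHS]/=.
move: (IHn (fun u => F (true :: u))) (IHn (fun u => F (false :: u))) => /= -> ->.
by rewrite addrACA.
Qed.

(** For a rotation by one letter, splitting on the first letter becomes splitting on the last one;
    the other rotations are iterates. *)
Lemma wsum_rot (V : nmodType) n j (F : seq bool -> V) :
  (j <= n)%N -> wsum n (fun u => F (rot j u)) = wsum n F.
Proof.
have rot1 (G : seq bool -> V) : wsum n (fun u => G (rot 1 u)) = wsum n G.
  case: n => [|m] //; rewrite [RHS]wsum_rcons /=.
  by congr (_ + _); apply: eq_wsum => u _; rewrite rot1_cons.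
elim: j F => [|j IHj] F ltjn; first by apply: eq_wsum => u _; rewrite rot0.
rewrite -[RHS]rot1 -[RHS](IHj (fun u => F (rot 1 u))) ?(ltnW ltjn) //.
by apply: eq_wsum => u su; rewrite rotS // su.
Qed.

Definition ins (j : nat) (u : seq bool) := take j u ++ true :: drop j u.

(** Prepares the double counting of insertions: a marked one of a word is a one inserted at its
    position. *)
Lemma wsum_ins n j (F : seq bool -> nat) : (j <= n)%N ->
  wsum n.+1 (fun u => nth false u j * F u)%N = wsum n (fun u => F (ins j u)).
Proof.
elim: j n F => [|j IHj] n F.
  move=> _ /=.
  rewrite [X in _ + X](_ : _ = 0) ?addr0; last first.
    by rewrite -[RHS](@wsum0 nat n); apply: eq_wsum => u _ /=; rewrite mul0n.
  by apply: eq_wsum => u _ /=; rewrite mul1n /ins take0 drop0.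
case: n => // n ltjn; rewrite [LHS]/= [RHS]/=.
by move: (IHj n (fun u => F (true :: u)) ltjn) (IHj n (fun u => F (false :: u)) ltjn)
  => /= -> ->.
Qed.

Lemma wsumS n (F : seq bool -> nat) :
  wsum n.+1 F = (wsum n (fun u => F (true :: u)) +
                 wsum n (fun u => F (false :: u)))%N.
Proof. by []. Qed.

Lemma leq_wsum n (F G : seq bool -> nat) :
  (forall u, size u = n -> (F u <= G u)%N) -> (wsum n F <= wsum n G)%N.
Proof.
elim: n F G => [|n IHn] F G FG; first by apply: FG.
by rewrite !wsumS; apply: leq_add; apply: IHn => u su; apply: FG; rewrite /= su.
Qed.

Lemma ltn_wsum n (F G : seq bool -> nat) v : size v = n -> (F v < G v)%N ->
  (forall u, size u = n -> (F u <= G u)%N) -> (wsum n F < wsum n G)%N.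
Proof.
elim: n F G v => [|n IHn] F G [|x v] // [sv] ltv FG.
have FG' y u : size u = n -> (F (y :: u) <= G (y :: u))%N.
  by move=> su; apply: FG; rewrite /= su.
rewrite !wsumS; case: x ltv => ltv.
  rewrite -addSn; apply: leq_add; last by apply: leq_wsum; apply: FG'.
  exact: (IHn (fun u => F (true :: u)) (fun u => G (true :: u)) v sv ltv (FG' true)).
rewrite -addnS; apply: leq_add; first by apply: leq_wsum; apply: FG'.
exact: (IHn (fun u => F (false :: u)) (fun u => G (false :: u)) v sv ltv (FG' false)).
Qed.

Lemma wsumMl n (m : nat) (F : seq bool -> nat) :
  wsum n (fun u => m * F u)%N = (m * wsum n F)%N.
Proof. by elim: n F => [|n IHn] F //; rewrite !wsumS !IHn -mulnDr. Qed.

Local Close Scope ring_scope.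

(** * The family [below q] of subsequences *)

(* [below q] is a family of subsequences of [q] that contains every [u] for
   which [rcons u true] is a subsequence of [q]. At the first letter where [u]
   and [q] differ, [q] having a one allows any subsequence of what remains. *)
Fixpoint below (q u : seq bool) : bool :=
  if q is c :: s then
    if u is x :: u' then
      if x == c then below s u'
      else if c then subseq u s else subseq (rcons u true) s
    else true \in q
  else false.

Lemma below_subseq q u : below q u -> subseq u q.
Proof.
elim: q u => [|c s IHs] [|x u] //=.
case: eqP => // _; first exact: IHs.
by case: c => // /(subseq_trans (subseq_rcons (x :: u) true)).
Qed.

Lemma subseq_below q u : subseq (rcons u true) q -> below q u.
Proof.
elim: q u => [|c s IHs] [|x u] //=.
- by case: c => //=; rewrite sub1seq.
- case: eqP => [_|/eqP neq]; first exact: IHs.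
  by case: c neq => // _; apply: subseq_trans; exact: (subseq_rcons (x :: u)).
Qed.

Lemma subseq_delete (u v : seq bool) x : subseq (u ++ v) (u ++ x :: v).
Proof. by rewrite subseq_cat2l subseq_cons. Qed.

(** The definition of [below] is made for this closure. A one of [q] left free by the deletion asks
    only for a subsequence, which [below_subseq] gives; a deleted one that faced a zero of [q]
    leaves an embedding with a final one, which [subseq_below] turns back. *)
Lemma below_delete q u v : below q (u ++ true :: v) -> below q (u ++ v).
Proof.
elim: q u v => [|c s IHs] [|x u] v //=.
- case: c => /=.
    case: v => [|[] v] /=; first by rewrite inE.
      exact: (IHs [::]).
    exact: below_subseq.
  case: v => [|[] v] /= sub.
  + by rewrite inE /= -sub1seq; apply: subseq_trans sub.
  + exact: subseq_trans (subseq_cons _ _) sub.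
  + apply: subseq_below; apply: subseq_trans sub.
    by apply: subseq_trans (subseq_cons _ true); apply: subseq_cons.
- case: eqP => [_|_]; first exact: IHs.
  case: c; apply: subseq_trans.
    exact: (subseq_delete (x :: u)).
  by rewrite -!cats1 -!catA; exact: (subseq_delete (x :: u)).
Qed.

Lemma nseq_subseq n b (s : seq bool) :
  n <= count_mem b s -> subseq (nseq n b) s.
Proof.
elim: s n => [|c s IHs] [|n] //=; rewrite eq_sym.
by case: eqP => _; [rewrite ltnS; exact: IHs | exact: (IHs n.+1)].
Qed.

Lemma count_below q u : below q u -> count_mem true u < count_mem true q.
Proof.
elim: q u => [|c s IHs] [|x u] //=.
  by move=> cs; rewrite -/(count_mem true (c :: s)) -has_count has_pred1.
case: eqP => [->|/eqP]; first by rewrite ltn_add2l; exact: IHs.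
case: c x => [] [] // _ /(leq_count_subseq (pred1 true)) /=; first by lia.
by rewrite -cats1 count_cat /=; lia.
Qed.

(** The word copies [q] while both a one remains in the rest of [q] and a zero is still wanted; it
    then ends with a constant block. *)
Lemma below_ex q a : 0 < count_mem true q -> a <= count_mem false q ->
  exists u, [/\ below q u, count_mem false u = a &
                count_mem true u = (count_mem true q).-1].
Proof.
elim: q a => [//|[] s IHs] a /=; rewrite ?add0n ?add1n /=.
  move=> _.
  case: (posnP (count_mem true s)) => [s0|s_gt0] le_a.
    exists (nseq a false); rewrite !count_nseq s0 mul1n; split=> //.
    by case: a le_a => [|a] le_a //=; apply: (@nseq_subseq a.+1).
  have [u [bu cu cu1]] := IHs a s_gt0 le_a.
  by exists (true :: u); split=> //=; rewrite cu1 add1n prednK.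
move=> s_gt0; case: a => [|a] le_a.
  exists (nseq (count_mem true s).-1 true); rewrite !count_nseq mul1n.
  split=> //; have := @nseq_subseq (count_mem true s) true s (leqnn _).
  case: (count_mem true s) s_gt0 => // -[|n] _ /=; first by rewrite sub1seq.
  by have -> : rcons (nseq n true) true = nseq n.+1 true
    by rewrite -cats1 -(nseqD n 1) addn1.
have [u [bu cu cu1]] := IHs a s_gt0 le_a.
by exists (false :: u); split; rewrite //= cu.
Qed.

(** * Long blocks of ones, and exchange of letters inside [below q] *)

(* [s] starts with at least [e] ones, and each of its zeros is followed by at
   least [r] ones before the next zero or the end of [s]. *)
Fixpoint blocks (r e : nat) (s : seq bool) : bool :=
  if s is c :: s' then
    if e is e'.+1 then c && blocks r e' s'
    else if c then blocks r 0 s' else blocks r r s'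
  else e == 0.

(* The words with few ones in a row, so that they embed in a word of [blocks]. *)
Fixpoint slots (r e : nat) (v : seq bool) : bool :=
  if v is x :: v' then
    if x then (if e is e'.+1 then slots r e' v' else false) else slots r r v'
  else true.

(** Greedy matching: [e] ones are guaranteed before the next zero of [s], so a one of [v] is matched
    at once and a zero of [v] skips to the next zero of [s]. *)
Lemma blocks_subseq r e s v : blocks r e s -> slots r e v ->
  count_mem false v <= count_mem false s -> subseq v s.
Proof.
elim: s e v => [|c s IHs] e [|x v] //=.
  by case: x => //=; case: e.
case: e => [|e]; first by case: c; case: x => //= bl sl; rewrite ?add0n ?add1n;
  [exact: (IHs 0 (false :: v)) | exact: (IHs r)].
case/andP=> -> bl; case: x => /= sl; rewrite ?add0n; first exact: IHs sl.
exact: (IHs e (false :: v)).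
Qed.

Lemma slots_count r e v : count_mem true v <= e -> e <= r -> slots r e v.
Proof.
elim: v e => [|[] v IHv] e //=; rewrite ?add1n ?add0n.
  by case: e => // e; rewrite ltnS => ? /ltnW; exact: IHv.
by move=> le_e le_r; apply: IHv => //; exact: leq_trans le_r.
Qed.

(** The appended one falls after a zero, in a block of capacity [r] that cannot be full, since [v]
    has fewer than [r] ones. *)
Lemma slots_rcons r e v : count_mem true v <= e -> count_mem true v < r ->
  e <= r -> false \in v -> slots r e (rcons v true).
Proof.
elim: v e => [|[] v IHv] e //=; rewrite ?add1n ?add0n ?inE /=.
  by case: e => // e; rewrite ltnS => le_e /ltnW lt_r /ltnW; exact: IHv.
by move=> _ lt_r _ _; apply: slots_count => //; rewrite -cats1 count_cat /=; lia.
Qed.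

Lemma blocks_below r q u : 0 < r -> blocks r r q ->
  count_mem false u <= count_mem false q -> count_mem true u <= r ->
  false \in u -> below q u.
Proof.
move=> r_gt0 bl le0 le1 uF; case: u le0 le1 uF => [|[] u] // le0 le1 uF.
  apply: subseq_below; apply: (blocks_subseq bl); last first.
    by rewrite -cats1 count_cat /= !addn0.
  move: le1 uF; case: r r_gt0 {bl} => // r _ /=.
  by rewrite add1n ltnS inE /= => le1 uF; apply: slots_rcons.
(* A leading zero differs from the leading one of [q], so a plain subsequence is enough. *)
have sub: subseq (false :: u) q by apply: (blocks_subseq bl) => //; exact: slots_count.
by case: r r_gt0 bl {le1} => // r _; case: q sub {le0} => [|[] q].
Qed.

(** Each test word uses all [m] zeros of [s], so its zeros sit on those of [s] and its run of ones
    must fit in one prescribed block. *)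
Lemma subseq_blocks r e m s : count_mem false s = m ->
  subseq (nseq e true ++ nseq m false) s ->
  (forall j, 0 < j <= m ->
     subseq (nseq j false ++ nseq r true ++ nseq (m - j) false) s) ->
  blocks r e s.
Proof.
elim: s e m => [|c s IHs] e m /=.
  by move=> <-; rewrite cats0; case: e.
case: e => [|e] /=.
  case: c => /=; rewrite ?add0n ?add1n => cs sub0 sub.
    apply: (IHs 0 m) => //=; first by case: {cs sub} m sub0 => //; rewrite sub0seq.
    by case=> // j lej; have:= sub _ lej.
  case: m cs sub0 sub => // m [cs] _ sub.
  apply: (IHs r m) => //; first by have:= sub 1; rewrite subn1; apply.
  by move=> j /andP[j_gt0 le_j]; have:= sub j.+1; rewrite subSS; apply.
case: c => /=; rewrite ?add0n ?add1n => cs sub0 sub.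
  by apply: (IHs e m) => // -[] // j lej; have:= sub _ lej.
have := leq_count_subseq (pred1 false) sub0.
by rewrite /= count_cat !count_nseq /= -cs; lia.
Qed.

(** A zero crosses a one to its left by inserting a one after the zero and deleting the one before
    it. *)
Lemma exchange_right q a b u v n :
  (forall u v, below q (u ++ v) ->
     count_mem true (u ++ v) = b -> count_mem false (u ++ v) = a ->
     below q (u ++ true :: v)) ->
  below q (u ++ nseq n true ++ false :: v) ->
  count_mem true (u ++ nseq n true ++ false :: v) = b ->
  count_mem false (u ++ nseq n true ++ false :: v) = a ->
  below q (u ++ false :: nseq n true ++ v).
Proof.
move=> insP; elim: n u => [|n IHn] u //= bl c1 c0.
have bl1 : below q ((u ++ [:: true; false]) ++ nseq n true ++ v).
  have := IHn (rcons u true); rewrite !cat_rcons -catA; apply => //.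
have {bl1} : below q ((u ++ [:: true; false]) ++ true :: nseq n true ++ v).
  by apply: insP => //; [rewrite -c1 | rewrite -c0];
    rewrite !(count_cat, count_nseq) /= !(count_cat, count_nseq) /=; lia.
by rewrite -catA => /below_delete.
Qed.

(** The letters of [w] are brought to the front one by one: a one by inserting it and deleting
    another, a zero by [exchange_right]. *)
Lemma exchange q a b u v w :
  (forall u v, below q (u ++ v) ->
     count_mem true (u ++ v) = b -> count_mem false (u ++ v) = a ->
     below q (u ++ true :: v)) ->
  below q (u ++ v) ->
  count_mem true (u ++ v) = b -> count_mem false (u ++ v) = a ->
  count_mem true w = count_mem true v -> count_mem false w = count_mem false v ->
  below q (u ++ w).
Proof.
move=> insP; elim: w u v => [|x w IHw] u v bl c1 c0 w1 w0.
  by case: v bl c1 c0 w1 w0 => [|[] v].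
suff [v' [bl' w1' w0']] : exists v', [/\ below q (u ++ x :: v'),
    count_mem true (x :: v') = count_mem true v &
    count_mem false (x :: v') = count_mem false v].
  rewrite -cat_rcons; apply: (IHw _ v'); rewrite ?cat_rcons //.
  - by rewrite -c1 !count_cat w1'.
  - by rewrite -c0 !count_cat w0'.
  - by move: w1; rewrite -w1' /= => /addnI.
  - by move: w0; rewrite -w0' /= => /addnI.
case: x w1 w0 => /=; rewrite ?add0n ?add1n => w1 w0.
  have vT : true \in v by rewrite -has_pred1 has_count -w1.
  case/splitPr: vT bl c1 c0 w1 w0 => v1 v2 bl c1 c0 w1 w0; exists (v1 ++ v2).
  split; last 2 first.
  - by rewrite !count_cat /=; lia.
  - by rewrite !count_cat /=.
  have := insP _ _ bl c1 c0; rewrite -[true :: v1 ++ _]/((true :: v1) ++ _) catA.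
  by move/below_delete; rewrite -catA.
have [n [v' v_eq]] : exists n v', v = nseq n true ++ false :: v'.
  have : false \in v by rewrite -has_pred1 has_count -w0.
  elim: v {bl c1 c0 w1 w0} => [|[] v IHv] //; last by exists 0, v.
  by rewrite inE /= => /IHv[n [v' ->]]; exists n.+1, v'.
subst v; exists (nseq n true ++ v'); split.
- exact: exchange_right insP _ _ _.
- by rewrite !count_cat /= !add0n.
- by rewrite !count_cat /= !count_nseq /=; lia.
Qed.

Local Open Scope ring_scope.

(** * The transfer matrix and generating functions of subsequences *)

(* Entry (c, d) of the transfer matrix of [s]: the sum of X ^ (wt a + wt b) over
   the words a and b whose sum with carry-in [c] is [s] with carry-out [d]. *)
Fixpoint cpoly (s : seq bool) (c d : bool) : {poly int} :=
  if s is t :: s' then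
    if t == c then cpoly s' false d + 'X^2 * cpoly s' true d
    else 2%:R * 'X * cpoly s' c d
  else (c == d)%:R.

(** Equal carry-in and carry-out: the carry out of the top digit re-enters at the lowest one, as in
    addition modulo [2 ^ k - 1]. *)
Definition ctrace (s : seq bool) : {poly int} :=
  cpoly s false false + cpoly s true true.

(* A word of length n in [P] with i ones contributes (2X) ^ (m - n) * X ^ (2 i). *)
Fixpoint gf (m : nat) (P : pred (seq bool)) : {poly int} :=
  (P [::])%:R * (2%:R * 'X) ^+ m +
  (if m is m'.+1 then
     'X^2 * gf m' (fun u => P (true :: u)) + gf m' (fun u => P (false :: u))
   else 0).

Lemma gfS m (P : pred (seq bool)) :
  gf m.+1 P = (P [::])%:R * (2%:R * 'X) ^+ m.+1 +
    ('X^2 * gf m (fun u => P (true :: u)) + gf m (fun u => P (false :: u))).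
Proof. by []. Qed.

Lemma eq_gf m (P Q : pred (seq bool)) : P =1 Q -> gf m P = gf m Q.
Proof.
elim: m P Q => [|m IHm] P Q PQ /=; first by rewrite PQ.
by rewrite PQ; congr (_ + (_ * _ + _)); apply: IHm => u.
Qed.

Lemma gf0 m : gf m pred0 = 0.
Proof.
by elim: m => [|m IHm] /=; rewrite ?(eq_gf _ (_ : _ =1 pred0)) ?IHm // ?mulr0 !(mul0r, addr0).
Qed.

Lemma gf_widen m (P : pred (seq bool)) : (forall u, P u -> (size u <= m)%N) ->
  gf m.+1 P = 2%:R * 'X * gf m P.
Proof.
elim: m P => [|m IHm] P sP.
  have P1 b : P [:: b] = false by apply/negP => /sP.
  by rewrite /= !P1 !mul0r !addr0 mulr0 addr0 expr1 expr0 mulr1 mulrC.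
have := IHm (fun u => P (true :: u)) (fun u => sP (true :: u)).
have := IHm (fun u => P (false :: u)) (fun u => sP (false :: u)).
move=> eqF eqT.
by rewrite (gfS m.+1) eqF eqT (gfS m P) exprS; ring.
Qed.

Definition letter (x : bool) : {poly int} := if x then 'X^2 else 1.

(* The part of the generating function of the subsequences of [s] made of the
   words that start with [x]; in [gext], only those that remain subsequences
   once extended by a one. *)
Definition gsub (x : bool) (s : seq bool) : {poly int} :=
  if s is c :: s' then
    letter x * gf (size s') (fun u => subseq (x :: u) s)
  else 0.

Definition gext (x : bool) (s : seq bool) : {poly int} :=
  if s is c :: s' then
    letter x *
      gf (size s') (fun u => subseq (x :: rcons u true) s)
  else 0.

Lemma gf_subseq s :
  gf (size s) (fun u => subseq u s) =
    (2%:R * 'X) ^+ size s + gsub false s + gsub true s.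
Proof.
by case: s => [|c s] /=; rewrite /letter ?sub0seq; ring.
Qed.

Lemma gf_subseq_rcons s :
  gf (size s) (fun u => subseq (rcons u true) s) =
    (true \in s)%:R * (2%:R * 'X) ^+ size s + gext false s + gext true s.
Proof.
case: s => [|c s]; first by rewrite /=; ring.
by rewrite [LHS]/= /gext /letter -sub1seq /=; ring.
Qed.

Lemma gsub_eq x s : gsub x (x :: s) =
  letter x *
    ((2%:R * 'X) ^+ size s + gsub false s + gsub true s).
Proof.
rewrite -gf_subseq /gsub; congr (_ * _); apply: eq_gf => u.
by rewrite /= eqxx.
Qed.

Lemma gf_cons x (Q : pred (seq bool)) s : (forall u, Q u -> subseq u s) ->
  gf (size s) (fun u => Q (x :: u)) = 2%:R * 'X * (if s is _ :: s' then gf (size s') (fun u => Q (x :: u)) else 0).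
Proof.
case: s => [|c s] Qs.
  rewrite mulr0 -[RHS](gf0 0); apply: eq_gf => u /=.
  by apply/negP => /Qs.
by apply: gf_widen => u /Qs /size_subseq.
Qed.

Lemma gf_gsub x s :
  letter x * gf (size s) (fun u => subseq (x :: u) s) = 2%:R * 'X * gsub x s.
Proof.
rewrite (@gf_cons x (fun u => subseq u s)) //.
by case: s => [|c s]; rewrite /gsub ?mulr0 // mulrCA.
Qed.

Lemma gsub_neq x s : gsub x (~~ x :: s) = 2%:R * 'X * gsub x s.
Proof.
by rewrite -gf_gsub [LHS]/=; congr (_ * _); apply: eq_gf => u; case: x.
Qed.

Lemma gext_eq x s : gext x (x :: s) =
  letter x *
    ((true \in s)%:R * (2%:R * 'X) ^+ size s + gext false s + gext true s).
Proof.
rewrite -gf_subseq_rcons /gext; congr (_ * _); apply: eq_gf => u.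
by rewrite /= eqxx.
Qed.

Lemma gf_gext x s :
  letter x * gf (size s) (fun u => subseq (x :: rcons u true) s) =
  2%:R * 'X * gext x s.
Proof.
rewrite (@gf_cons x (fun u => subseq (rcons u true) s)); last first.
  by move=> u; exact: subseq_trans (subseq_rcons _ _).
by case: s => [|c s]; rewrite /gext ?mulr0 // mulrCA.
Qed.

Lemma gext_neq x s : gext x (~~ x :: s) = 2%:R * 'X * gext x s.
Proof.
by rewrite -gf_gext [LHS]/=; congr (_ * _); apply: eq_gf => u; case: x.
Qed.

(** Both sides obey the same recursion on [s], because [1 + X^2 - (1 - X)^2 = 2X]. Row sums of the
    transfer matrix thus count subsequences. *)
Lemma gsubE x s :
  - (1 - 'X) ^+ 2 * gsub x s = letter x *
      ((2%:R * 'X) ^+ size s - cpoly s x false - cpoly s x true).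
Proof.
elim: s x => [|c s IHs] x.
  by case: x; rewrite /letter /=; ring.
case: (boolP (c == x)) => [/eqP->|neq].
  rewrite gsub_eq /= eqxx.
  have := IHs true; have := IHs false => /= eqF eqT.
  rewrite [(2%:R * 'X) ^+ (size s).+1]exprS.
  transitivity (letter x *
    (- (1 - 'X) ^+ 2 * (2%:R * 'X) ^+ size s +
     - (1 - 'X) ^+ 2 * gsub false s + - (1 - 'X) ^+ 2 * gsub true s));
    first by ring.
  by rewrite eqF eqT /letter; ring.
have {neq}-> : c = ~~ x by case: c x neq => [] [].
rewrite gsub_neq /=.
have -> : (~~ x == x) = false by case: x.
by rewrite mulrCA IHs [(2%:R * 'X) ^+ (size s).+1]exprS; case: x; rewrite /letter; ring.
Qed.

(** The column of carry-out one counts the subsequences of [s] that cease to be so once a one is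
    appended. *)
Lemma gextE s :
  [/\ (~~ (true \in s))%:R * (2%:R * 'X) ^+ size s + gsub true s - gext true s
         = cpoly s true true &
      'X^2 * (gsub false s - gext false s) = cpoly s false true].
Proof.
elim: s => [|[] s [IH1 IH0]].
- by split=> /=; ring.
- rewrite [in gsub false _](_ : true = ~~ false) // gsub_neq.
  rewrite [in gext false _](_ : true = ~~ false) // gext_neq gsub_eq gext_eq.
  rewrite inE /= /letter -IH1 -IH0; split; last by ring.
  by case: (true \in s) => /=; ring.
- rewrite [in gsub true _](_ : false = ~~ true) // gsub_neq.
  rewrite [in gext true _](_ : false = ~~ true) // gext_neq gsub_eq gext_eq.
  rewrite inE /= /letter -IH1 -IH0 [(2%:R * 'X) ^+ (size s).+1]exprS; split; first by ring.
  by case: (true \in s) => /=; ring.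
Qed.

Lemma gf_below_true s : gf (size s).+1 (below (true :: s)) =
  (2%:R * 'X) ^+ (size s).+1 +
  ('X^2 * gf (size s) (below s) + 2%:R * 'X * gsub false s).
Proof. by rewrite gfS mul1r -gf_gsub /letter mul1r. Qed.

Lemma gf_below_false s : gf (size s).+1 (below (false :: s)) =
  (true \in s)%:R * (2%:R * 'X) ^+ (size s).+1 +
  (2%:R * 'X * gext true s + gf (size s) (below s)).
Proof. by rewrite gfS -gf_gext. Qed.

(** Induction on [q]: [gsubE] and [gextE] turn the terms in which [below] leaves the recursion into
    matrix entries, and a ring identity remains. *)
Lemma ctraceE q : ctrace (false :: q) =
  (2%:R * 'X) ^+ (size q).+1 + 'X^2 ^+ count_mem true q
  + (1 - 'X) ^+ 2 * gf (size q) (below q).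
Proof.
elim: q => [|c s IHs]; first by rewrite /ctrace /=; ring.
have eqF := gsubE false s; have eqT := gsubE true s.
have [eqTT eqFT] := gextE s; rewrite /letter in eqF eqT.
have {}IHs : (1 - 'X) ^+ 2 * gf (size s) (below s) =
    cpoly s false false + 'X^2 * cpoly s true false + 2%:R * 'X * cpoly s true true
    - (2%:R * 'X) ^+ (size s).+1 - 'X^2 ^+ count_mem true s.
  by move: IHs; rewrite /ctrace /= => ->; ring.
have {}eqF : (1 - 'X) ^+ 2 * gsub false s =
    cpoly s false false + cpoly s false true - (2%:R * 'X) ^+ size s.
  by rewrite -[LHS]opprK -mulNr eqF; ring.
have {}eqT : (1 - 'X) ^+ 2 * gsub true s =
    'X^2 * (cpoly s true false + cpoly s true true - (2%:R * 'X) ^+ size s).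
  by rewrite -[LHS]opprK -mulNr eqT; ring.
rewrite -[size (c :: s)]/(size s).+1.
rewrite [(2%:R * 'X) ^+ (size s).+2]exprS.
case: c.
  rewrite gf_below_true !mulrDr (mulrCA _ (2%:R * 'X)) eqF (mulrCA _ 'X^2) IHs.
  rewrite /ctrace /= add1n ![(2%:R * 'X) ^+ (_).+1]exprS ['X^2 ^+ (_).+1]exprS.
  ring.
rewrite gf_below_false !mulrDr IHs (mulrCA _ (2%:R * 'X)).
have -> : gext true s =
    (~~ (true \in s))%:R * (2%:R * 'X) ^+ size s + gsub true s - cpoly s true true.
  by rewrite -eqTT; ring.
rewrite [(1 - 'X) ^+ 2 * (_ - _)]mulrBr [(1 - 'X) ^+ 2 * (_ + gsub _ _)]mulrDr eqT.
rewrite /ctrace /= add0n ![(2%:R * 'X) ^+ (_).+1]exprS.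
by case: (true \in s) => /=; ring.
Qed.

Local Close Scope ring_scope.

(** * Balanced words: [nbal q n] is the number e_n, and insertions of a one are counted in two
    ways *)

Definition nbal (q : seq bool) (n : nat) : nat :=
  wsum n (fun u => below q u && (count_mem true u == n./2) : nat).

Lemma count_ins j u : count_mem true (ins j u) = (count_mem true u).+1.
Proof.
by rewrite /ins -[in RHS](cat_take_drop j u) !count_cat /= add1n addnS.
Qed.

Lemma below_ins q j u : below q (ins j u) -> below q u.
Proof. by move/below_delete; rewrite cat_take_drop. Qed.

(** Each word of length [2i + 2] counted on the left has [i + 1] ones, hence arises from [i + 1]
    pairs of a shorter word and a position. *)
Lemma nbal_ins q i :
  i.+1 * nbal q i.*2.+2 =
  wsum i.*2.+1 (fun u => \sum_(j < i.*2.+2)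
    (below q (ins j u) && (count_mem true u == i))).
Proof.
rewrite -wsum_sum.
transitivity (\sum_(j < i.*2.+2) wsum i.*2.+2 (fun u => nth false u j *
  (below q u && (count_mem true u == i.+1)))); last first.
  apply: eq_bigr => j _.
  rewrite (wsum_ins (fun u => (below q u && (count_mem true u == i.+1)) : nat));
    last by rewrite -ltnS.
  by apply: eq_wsum => u _; rewrite count_ins eqSS.
rewrite wsum_sum /nbal -wsumMl; apply: eq_wsum => u su.
rewrite -big_distrl /= doubleK.
case: eqP => [cu|_]; last by rewrite andbF !muln0.
congr (_ * _); rewrite -[RHS]/(\sum_(j < i.*2.+2) (fun j => nth false u j : nat) j).
rewrite -su -(big_mkord xpredT (fun j => nth false u j : nat)).
rewrite -(big_nth false xpredT (fun b => b : nat)) -cu.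
by elim: (u) => [|b v IHv]; rewrite ?big_nil // big_cons /= IHv; case: b.
Qed.

Lemma nbalMS q i :
  i.*2.+2 * nbal q i.*2.+1 =
  wsum i.*2.+1 (fun u => \sum_(j < i.*2.+2)
    (below q u && (count_mem true u == i))).
Proof.
rewrite /nbal -wsumMl; apply: eq_wsum => u _.
by rewrite sum_nat_const card_ord /= uphalf_double.
Qed.

(** By [below_delete], an insertion that lands in [below q] starts from a word of [below q]. *)
Lemma nbal_le q i : nbal q i.*2.+2 <= 2 * nbal q i.*2.+1.
Proof.
have : i.+1 * nbal q i.*2.+2 <= i.+1 * (2 * nbal q i.*2.+1).
  rewrite mulnA muln2 doubleS nbal_ins nbalMS.
  apply: leq_wsum => u _; apply: leq_sum => j _.
  by case bl: (below q (ins j u)); rewrite ?(below_ins bl).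
by rewrite leq_pmul2l.
Qed.

Lemma nbal_eqP q i :
  reflect (forall j u, size u = i.*2.+1 -> count_mem true u = i -> below q u ->
             j < i.*2.+2 -> below q (ins j u))
          (nbal q i.*2.+2 == 2 * nbal q i.*2.+1).
Proof.
rewrite -(eqn_pmul2l (ltn0Sn i)) mulnA muln2 doubleS nbal_ins nbalMS.
apply: (iffP eqP) => [eqw j u su cu bl ltj|clos]; last first.
  apply: eq_wsum => u su; apply: eq_bigr => j _; congr nat_of_bool.
  case: eqP => [cu|]; last by rewrite !andbF.
  rewrite !andbT; apply/idP/idP => [/below_ins //|bl].
  exact: clos.
apply/negPn/negP => nbl; move/eqP: eqw; apply/negP; rewrite neq_ltn.
apply/orP; left; apply: (ltn_wsum su); last first.
  move=> v _; apply: leq_sum => l _.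
  by case blv: (below q (ins l v)); rewrite ?(below_ins blv).
rewrite (bigD1 (Ordinal ltj)) //= [X in _ < X](bigD1 (Ordinal ltj)) //=.
rewrite (negPf nbl) bl cu eqxx /= add0n add1n ltnS.
apply: leq_sum => l _.
by case blv: (below q (ins l u)).
Qed.

Lemma nbal0 q : true \in q -> nbal q 0 = 1.
Proof. by case: q => // c s tq; rewrite /nbal /= tq. Qed.

Lemma nbal_size q : nbal q (size q).+1 = 0.
Proof.
rewrite -[RHS](@wsum0 nat (size q).+1); apply: eq_wsum => u su.
case bl: (below q u) => //; have := size_subseq (below_subseq bl).
by rewrite su ltnn.
Qed.

Local Open Scope ring_scope.

(** * Low-order coefficients of the trace *)

Lemma wsumZ (R : pzSemiRingType) n (c : R) (F : seq bool -> R) :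
  wsum n (fun u => c * F u) = c * wsum n F.
Proof. by elim: n F => [|n IHn] F //=; rewrite !IHn mulrDr. Qed.

Lemma gfE m (P : pred (seq bool)) : gf m P = \sum_(n < m.+1) wsum n
  (fun u => (P u)%:R * ((2%:R * 'X) ^+ (m - n) * 'X^2 ^+ count_mem true u)).
Proof.
elim: m P => [|m IHm] P; first by rewrite big_ord1 /= expr0 !mulr1 addr0.
rewrite gfS !IHm [RHS]big_ord_recl.
congr (_ + _); first by rewrite /= subn0 expr0 mulr1.
rewrite big_distrr /= -big_split /=; apply: eq_bigr => n _.
rewrite subSS; congr (_ + _).
rewrite -wsumZ; apply: eq_wsum => u _ /=; rewrite add1n ['X^2 ^+ _.+1]exprS; ring.
Qed.

Lemma natr_wsum n (F : seq bool -> nat) :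
  (wsum n F)%:R = wsum n (fun u => (F u)%:R) :> int.
Proof. by elim: n F => [|n IHn] F //; rewrite wsumS natrD !IHn. Qed.

Lemma coef_gf m (d : bool) q : (d <= m)%N -> (gf m (below q))`_(m - d) =
  \sum_(n < m.+1) (odd n == d)%:R * (2 ^+ (m - n) * (nbal q n)%:R).
Proof.
move=> le_d; rewrite gfE coef_sum; apply: eq_bigr => n _.
rewrite -[LHS]/(coefp (m - d)%N _) raddf_wsum /= natr_wsum -!wsumZ.
apply: eq_wsum => u _ /=.
rewrite exprMn -mulrA -exprM -exprD -!natrX !mulr_natl !coefMn coefXn.
rewrite -!mulrnA; congr (_%:R); case: (below q u); last by rewrite !mul0n !muln0.
(* A word of length n with c ones has exponent m - n + 2c; exponent m - d fixes the parity of n and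
   forces c to be n/2 rounded down. *)
have -> : (m - d == m - n + 2 * count_mem true u)%N =
  (odd n == d) && (count_mem true u == n./2).
  have := ltn_ord n; have := odd_double_half n; move: le_d.
  by case: (odd n); case: d => /=; lia.
by case: (odd n == d); case: (_ == _); rewrite ?muln0 ?mul0n ?muln1 ?mul1n.
Qed.

Lemma lowsum_diff m (p : {poly int}) : \sum_(j < m.+1) ((1 - 'X) * p)`_j = p`_m.
Proof.
elim: m => [|m IHm]; first by rewrite big_ord1 mulrBl mul1r coefB coefXM subr0.
by rewrite big_ord_recr /= IHm mulrBl mul1r coefB coefXM /= addrC subrK.
Qed.

Lemma sum_coefXn m n : \sum_(j < m) ('X^n : {poly int})`_j = (n < m)%:R.
Proof.
case: ltnP => [lt_n|le_m].
  rewrite (bigD1 (Ordinal lt_n)) //= coefXn eqxx big1 ?addr0 // => j.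
  by rewrite coefXn -val_eqE => /negPf->.
by rewrite big1 // => j _; rewrite coefXn ltn_eqF // (leq_trans _ le_m).
Qed.

Definition lowsum (s : seq bool) : int := \sum_(j < size s) (ctrace s)`_j.

Lemma lowsumE q : lowsum (false :: q) =
  (2 * count_mem true q < (size q).+1)%:R +
  \sum_(n < (size q).+1) (-1) ^+ odd n * (2 ^+ (size q - n) * (nbal q n)%:R).
Proof.
set m := size q; rewrite /lowsum ctraceE [size _]/= -/m.
under eq_bigr do rewrite !coefD; rewrite !big_split /=; congr (_ + _).
  rewrite big1 ?add0r; last first.
    move=> j _; rewrite exprMn -natrX mulr_natl coefMn coefXn.
    by rewrite (ltn_eqF (ltn_ord j)) mul0rn.
  by rewrite -exprM sum_coefXn.
(* One factor [1 - X] telescopes in the partial sum; the other leaves the difference of the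
   coefficients of degree [m] and [m - 1], which see the even and the odd lengths. *)
rewrite expr2 -mulrA.
rewrite lowsum_diff mulrBl mul1r coefB coefXM.
have := @coef_gf m false q isT; rewrite subn0 => ->.
have -> : (if m == 0%N then 0 else (gf m (below q))`_m.-1) =
    \sum_(n < m.+1) (odd n == true)%:R * (2 ^+ (m - n) * (nbal q n)%:R).
  case: eqP => [->|/eqP]; first by rewrite big_ord1 mul0r.
  by rewrite -lt0n => m_gt0; rewrite -subn1 (@coef_gf m true).
rewrite -sumrB; apply: eq_bigr => n _; rewrite -mulrBl; congr (_ * _).
by case: (odd n).
Qed.

(** Each odd term is paired with the even term after it. The term [e 0] stays alone, and for odd [m]
    the last pair reaches [e m.+1], beyond the sum. *)
Lemma alternating_sum (e : nat -> int) m :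
  2 * (\sum_(n < m.+1) (-1) ^+ odd n * (2 ^+ (m - n) * e n)) =
  2 ^+ m.+1 * e 0%N
  - \sum_(n < m.+1) (odd n)%:R * (2 ^+ (m - n) * (2 * e n - e n.+1))
  - (odd m)%:R * e m.+1.
Proof.
elim: m => [|m IHm]; first by rewrite !big_ord1 /= !expr0; ring.
rewrite !(big_ord_recr m.+1) /= subnn expr0.
have -> : \sum_(n < m.+1) (-1) ^+ odd n * (2 ^+ (m.+1 - n) * e n) =
    2 * (\sum_(n < m.+1) (-1) ^+ odd n * (2 ^+ (m - n) * e n)).
  rewrite big_distrr; apply: eq_bigr => n _ /=.
  by rewrite (subSn (ltn_ord n : n <= m)%N) exprS; ring.
have -> : \sum_(n < m.+1) (odd n)%:R * (2 ^+ (m.+1 - n) * (2 * e n - e n.+1)) =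
    2 * (\sum_(n < m.+1) (odd n)%:R * (2 ^+ (m - n) * (2 * e n - e n.+1))).
  rewrite big_distrr; apply: eq_bigr => n _ /=.
  by rewrite (subSn (ltn_ord n : n <= m)%N) exprS; ring.
rewrite mulrDr IHm !exprS.
by case: (odd m) => /=; rewrite ?expr0 ?expr1; ring.
Qed.

Lemma lowsum2E q : true \in q -> 2 * lowsum (false :: q) =
  2 * (2 * count_mem true q < (size q).+1)%:R + 2 ^+ (size q).+1 -
  \sum_(n < (size q).+1) (odd n)%:R *
    (2 ^+ (size q - n) * (2 * (nbal q n)%:R - (nbal q n.+1)%:R)).
Proof.
move=> tq; rewrite lowsumE mulrDr (alternating_sum (fun n => (nbal q n)%:R)).
by rewrite nbal0 // nbal_size; ring.
Qed.

Local Close Scope ring_scope.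

(** * The equality case, and invariance under rotation *)

Lemma blocks_count r e s : blocks r e s ->
  e + r * count_mem false s <= count_mem true s.
Proof.
elim: s e => [|c s IHs] e /=; first by rewrite muln0 addn0 => /eqP->.
case: e => [|e]; last by case/andP=> -> /IHs /=; lia.
by case: c => /IHs /=; rewrite ?mulnDr; lia.
Qed.

Lemma count_false_true (s : seq bool) : count_mem false s + count_mem true s = size s.
Proof.
elim: s => //= b s <-; rewrite addnACA.
by case: b.
Qed.

Lemma size_ins j u : size (ins j u) = (size u).+1.
Proof. by rewrite /ins size_cat /= addnS -size_cat cat_take_drop. Qed.

Lemma count0_ins j u : count_mem false (ins j u) = count_mem false u.
Proof.
have := count_false_true (ins j u); have := count_false_true u.
by rewrite count_ins size_ins; lia.
Qed.

Lemma blocks_nbal q i : blocks (count_mem false q) (count_mem false q) q ->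
  nbal q i.*2.+2 = 2 * nbal q i.*2.+1.
Proof.
move=> bl; apply/eqP/nbal_eqP => j u su cu bu ltj.
have c0 : count_mem false u = i.+1.
  by have := count_false_true u; rewrite su cu; lia.
have le0 := leq_count_subseq (pred1 false) (below_subseq bu).
apply: (blocks_below _ bl); rewrite ?count0_ins ?count_ins ?cu //.
- by apply: leq_trans le0; rewrite c0.
- by rewrite -c0.
- by rewrite -has_pred1 has_count count0_ins c0.
Qed.

(** Closure under insertion gives [exchange], so all words with [i + 1] zeros and [i] ones lie in
    [below q]. One more insertion makes every word with [i + 1] zeros and [i + 1] ones a subsequence
    of [q], among them the test words of [subseq_blocks]. *)
Lemma nbal_blocks q i : true \in q -> count_mem false q = i.+1 ->
  i < count_mem true q -> nbal q i.*2.+2 = 2 * nbal q i.*2.+1 ->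
  blocks i.+1 i.+1 q.
Proof.
move=> tq c0 c1 /eqP/nbal_eqP clos.
have insP u v : below q (u ++ v) -> count_mem true (u ++ v) = i ->
    count_mem false (u ++ v) = i.+1 -> below q (u ++ true :: v).
  move=> bl cu1 cu0; have suv := count_false_true (u ++ v).
  have := clos (size u) _ _ cu1 bl; rewrite /ins take_size_cat // drop_size_cat //.
  by apply; move: suv; rewrite ?cu1 ?cu0 ?size_cat; lia.
(* Ones are deleted from the word of [below_ex] until [i] remain. *)
have [w0 [bw0 w00 w01]] : exists w,
    [/\ below q w, count_mem false w = i.+1 & count_mem true w = i].
  have [|w [bw w0 w1]] := @below_ex q i.+1 (leq_ltn_trans (leq0n i) c1).
    by rewrite c0.
  have : i <= count_mem true w by rewrite w1; lia.
  move: w1 => _; move w1: (count_mem true w) => n le_n.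
  elim: n w le_n w1 bw w0 => [|n IHn] w le_n w1 bw w0.
    by exists w; rewrite w1; split=> //; lia.
  case: (ltngtP i n.+1) le_n => // [lt_n|eq_n] _; last by exists w; rewrite w1; split.
  have wT : true \in w by rewrite -has_pred1 has_count w1.
  case/splitPr: wT w1 bw w0 => u v w1 /below_delete bw w0.
  apply: (IHn _ lt_n _ bw); rewrite ?count_cat /= -?w0 ?count_cat //=.
  by move: w1; rewrite !count_cat /=; lia.
have full v : count_mem false v = i.+1 -> count_mem true v = i.+1 -> subseq v q.
  move=> v0 v1; have vT : true \in v by rewrite -has_pred1 has_count v1.
  case/splitPr: vT v0 v1 => x y.
  rewrite !count_cat /= add0n add1n addnS => v0 [v1].
  apply: below_subseq; apply: (insP); rewrite ?count_cat //.
  by apply: (@exchange q i.+1 i [::] w0) => //=; rewrite count_cat ?w00 ?w01.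
apply: (@subseq_blocks _ _ i.+1) => // [|j le_j]; apply: full;
  rewrite !count_cat !count_nseq /=; lia.
Qed.

Lemma nbal_gt0 q u : below q u -> count_mem true u = (size u)./2 ->
  0 < nbal q (size u).
Proof.
move=> bu cu; rewrite -[X in X < _](@wsum0 nat (size u)).
by apply: (@ltn_wsum _ _ _ u) => //; rewrite bu cu eqxx.
Qed.

Lemma blocks00 s : blocks 0 0 s.
Proof. by elim: s => [|[] s IHs]. Qed.

Local Open Scope ring_scope.

Lemma lowsum_blocks (q : seq bool) : true \in q ->
  (lowsum (false :: q) == 2 ^+ size q) =
  blocks (count_mem false q) (count_mem false q) q.
Proof.
move=> tq; have := lowsum2E tq; rewrite exprS.
set T := \sum_(n < _) _ => eqT.
have term_ge0 (n : 'I_(size q).+1) : 0 <= (odd n)%:R *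
    (2 ^+ (size q - n) * (2 * (nbal q n)%:R - (nbal q n.+1)%:R)) :> int.
  case odd_n : (odd n); last by rewrite mul0r.
  rewrite mul1r mulr_ge0 ?exprn_ge0 // subr_ge0 -natrM ler_nat.
  by rewrite -[n : nat]odd_double_half odd_n add1n; exact: nbal_le.
have tq_gt0 : (0 < count_mem true q)%N by rewrite -has_count has_pred1.
have sq := count_false_true q.
case: (leqP (count_mem true q) (count_mem false q)) => [le_B|lt_B].
  have -> : blocks (count_mem false q) (count_mem false q) q = false.
    by apply/negP => /blocks_count; case: (count_mem false q) le_B => [|r]; lia.
  (* The witness has one fewer ones than [q] and as many zeros as [q] has ones. It is counted at its
     length, while the next count is 0 because words of [below q] have fewer ones than [q]. *)
  have [u [bu u0 u1]] := below_ex tq_gt0 le_B.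
  have su : size u = (count_mem true q).-1.*2.+1.
    by have := count_false_true u; rewrite u0 u1; lia.
  have lt_n : (size u < (size q).+1)%N by lia.
  have nbal_u : nbal q (size u).+1 = 0%N.
    rewrite -[RHS](@wsum0 nat (size u).+1); apply: eq_wsum => v _.
    case bv : (below q v) => //=; have := count_below bv.
    by case: eqP => //; rewrite su /= doubleK prednK // => ->; rewrite ltnn.
  have nbal_gt : (0 < nbal q (size u))%N.
    by apply: nbal_gt0 => //; rewrite su /= uphalf_double.
  (* The bound has to beat the 2 coming from the indicator; it reaches 4 because [size q - size u]
     is at least 1. *)
  have T_ge : 4 <= T.
    rewrite /T (bigD1 (Ordinal lt_n)) //= nbal_u subr0.
    rewrite -[X in X <= _]addr0 lerD //; last by apply: sumr_ge0 => n _.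
    have -> : odd (size u) by rewrite su /= odd_double.
    have -> : (size q - size u)%N = (count_mem false q - count_mem true q).+1.
      by lia.
    rewrite mul1r -natrM -natrX -natrM ler_nat expnS.
    have := expn_gt0 2 (count_mem false q - count_mem true q); nia.
  by apply/negbTE/eqP => eqS; move: eqT T_ge; rewrite eqS;
    case: (_ < _)%N => /=; move: (2 ^+ size q) T => x y; lia.
rewrite (_ : (2 * count_mem true q < (size q).+1)%N = false) in eqT; last by lia.
apply/eqP/idP => [eqS|bl].
  have T0 : T = 0 by move: eqT; rewrite eqS /=; move: (2 ^+ size q) T => x y; lia.
  case c0 : (count_mem false q) lt_B => [|i] lt_B; first exact: blocks00.
  (* A single vanishing term suffices, at the length [2i + 1] where the balanced words have exactly
     as many zeros as [q]. *)
  have lt_n : (i.*2.+1 < (size q).+1)%N by lia.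
  apply: nbal_blocks => //; first exact: ltnW.
  move/eqP: T0; rewrite /T psumr_eq0 => [|n _]; last exact: term_ge0.
  move/allP/(_ (Ordinal lt_n) (mem_index_enum _)) => /=.
  rewrite odd_double mul1r mulf_eq0 expf_eq0 andbF /= subr_eq0 -natrM eqr_nat.
  by move/eqP.
have T0 : T = 0.
  rewrite /T big1 // => n _; case odd_n : (odd n); last by rewrite mul0r.
  have nE : (n./2.*2.+1 = n)%N by rewrite -[RHS]odd_double_half odd_n.
  by have := blocks_nbal n./2 bl; rewrite nE => ->; rewrite natrM subrr !mulr0.
by move: eqT; rewrite T0 /=; move: (2 ^+ size q) (lowsum _) => x y; lia.
Qed.

Lemma cpoly_cat s1 s2 c d : cpoly (s1 ++ s2) c d =
  cpoly s1 c false * cpoly s2 false d + cpoly s1 c true * cpoly s2 true d.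
Proof.
elim: s1 c => [|t s1 IHs] c; first by case: c => /=; ring.
by rewrite /= !IHs; case: (t == c); ring.
Qed.

(** Concatenation is matrix product, and the trace of a product does not depend on the order of its
    two factors. *)
Lemma lowsum_rot n s : lowsum (rot n s) = lowsum s.
Proof.
suff cE : ctrace (rot n s) = ctrace s by rewrite /lowsum size_rot cE.
by rewrite -[in RHS](cat_take_drop n s) /ctrace /rot !cpoly_cat; ring.
Qed.

Local Close Scope ring_scope.

(** * Binary digits, and the cardinality of [Stk] as a partial sum of coefficients *)

Fixpoint bits (k t : nat) : seq bool :=
  if k is k'.+1 then odd t :: bits k' t./2 else [::].

Lemma size_bits k t : size (bits k t) = k.
Proof. by elim: k t => //= k IHk t; rewrite IHk. Qed.

Lemma bitS n i : bit n i.+1 = bit n./2 i.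
Proof. by rewrite /bit expnS divnMA divn2. Qed.

Lemma nth_bits k t i : i < k -> nth false (bits k t) i = bit t i.
Proof.
elim: k t i => // k IHk t [|i] lt_i; first by rewrite /bit divn1.
by rewrite bitS -IHk.
Qed.

Lemma word_bits k t : word k t = bits k t :> seq bool.
Proof.
apply: (@eq_from_nth _ false); rewrite ?size_tuple ?size_bits // => i lt_i.
by rewrite nth_bits // -[i]/(nat_of_ord (Ordinal lt_i)) -tnth_nth tnth_mktuple.
Qed.

Lemma count_bits k t : count_mem true (bits k t) = \sum_(i < k) bit t i.
Proof.
elim: k t => [|k IHk] t; first by rewrite big_ord0.
rewrite /= IHk big_ord_recl; congr (_ + _); first by rewrite /bit divn1; case: odd.
by apply: eq_bigr => i _; rewrite -bitS.
Qed.

Lemma wt_bits k n : n < 2 ^ k -> wt n = count_mem true (bits k n).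
Proof.
have cut m l : n < 2 ^ m -> \sum_(i < m + l) bit n i = \sum_(i < m) bit n i.
  move=> lt_n; rewrite big_split_ord /= [X in _ + X]big1 ?addn0 // => i _.
  rewrite /bit divn_small //; apply: leq_trans lt_n _.
  by rewrite leq_exp2l // leq_addr.
by move=> lt_n; rewrite count_bits -(cut k n) // addnC cut // ltn_expl.
Qed.

Lemma sum_double (V : nmodType) n (F : nat -> V) :
  (\sum_(a < n.*2) F a = \sum_(a < n) (F a.*2 + F a.*2.+1))%R.
Proof.
elim: n => [|n IHn]; first by rewrite !big_ord0.
by rewrite doubleS !big_ord_recr /= IHn -addrA.
Qed.

Lemma bits_double k t (b : bool) : bits k.+1 (b + t.*2) = b :: bits k t.
Proof. by rewrite /= half_bit_double oddD odd_double addbF oddb. Qed.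

Lemma sum_bits (V : nmodType) k (F : seq bool -> V) :
  (\sum_(t < 2 ^ k) F (bits k t) = wsum k F)%R.
Proof.
elim: k F => [|k IHk] F; first by rewrite big_ord1.
rewrite expnS mul2n (sum_double _ (fun t => F (bits k.+1 t))) big_split /= addrC.
by rewrite -!IHk; congr (_ + _)%R; apply: eq_bigr => t _; rewrite ?doubleK ?odd_double ?uphalf_double.
Qed.

Local Open Scope ring_scope.

Lemma cpoly_bits k t (c d : bool) : (t < 2 ^ k)%N -> cpoly (bits k t) c d =
  \sum_(a < 2 ^ k) \sum_(b < 2 ^ k) (a + b + c == t + 2 ^ k * d)%N%:R *
    'X^(count_mem true (bits k a) + count_mem true (bits k b))%N.
Proof.
elim: k t c => [|k IHk] t c lt_t.
  have -> : t = 0%N by lia.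
  by rewrite !big_ord1 /= mulr1; case: c d => [] [].
have tE := odd_double_half t; have lt_h : (t./2 < 2 ^ k)%N by rewrite expnS in lt_t; lia.
have -> : (2 ^ k.+1 = (2 ^ k).*2)%N by rewrite expnS mul2n.
rewrite (sum_double _ (fun a => \sum_(b < (2 ^ k).*2) (a + b + c == t + (2 ^ k).*2 * d)%N%:R *
    'X^(count_mem true (bits k.+1 a) + count_mem true (bits k.+1 b)))).
pose W a b : {poly int} := 'X^(count_mem true (bits k a) + count_mem true (bits k b))%N.
transitivity (\sum_(a < 2 ^ k) \sum_(b < 2 ^ k)
  (\sum_(x <- [:: false; true]) \sum_(y <- [:: false; true])
   (x + a.*2 + (y + b.*2) + c == t + (2 ^ k).*2 * d)%N%:R * 'X^(x + y) * W a b)); last first.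
  apply: eq_bigr => a _.
  rewrite !(sum_double _ (fun b => (_ + b + c == t + (2 ^ k).*2 * d)%N%:R *
    'X^(_ + count_mem true (bits k.+1 b)))) -big_split; apply: eq_bigr => b _.
  have := bits_double k a false; have := bits_double k b false.
  have := bits_double k a true; have := bits_double k b true.
  rewrite !add0n !add1n => -> -> -> ->.
  rewrite !big_cons !big_nil /W /= !add0n !add1n !addr0 !exprD.
  by rewrite ?expr0 ?expr1 !['X^(_.+1)]exprS; ring.
(* One column of the addition: the parity is the digit of [t], and half of the column sum is the
   carry passed on. *)
have halve (x : bool) a b y : (x + a.*2 + (y + b.*2) + c == t + (2 ^ k).*2 * d)%N =
    (odd (x + y + c) == odd t) && (a + b + (x + y + c)./2 == t./2 + 2 ^ k * d)%N.
  have := odd_double_half (x + y + c); have := tE.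
  by case: (odd t); case: (odd (x + y + c)); case: (d) => /=; lia.
have sub (e : bool) : cpoly (bits k t./2) e d =
    \sum_(a < 2 ^ k) \sum_(b < 2 ^ k) (a + b + e == t./2 + 2 ^ k * d)%N%:R * W a b.
  exact: IHk.
rewrite [LHS]/= !sub; under [RHS]eq_bigr => a _ do under eq_bigr => b _ do
  rewrite !big_cons !big_nil !halve /=.
by case: (c); case: (odd t) => /=; rewrite ?big_distrr -?big_split /=;
  apply: eq_bigr => a _; rewrite ?big_distrr -?big_split /=;
  apply: eq_bigr => b _; ring.
Qed.

Local Close Scope ring_scope.

Lemma bits_full k t : t < 2 ^ k ->
  (count_mem false (bits k t) == 0) = (t == 2 ^ k - 1).
Proof.
elim: k t => [|k IHk] t; first by case: t.
rewrite expnS => lt_t; have tE := odd_double_half t.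
rewrite /= addn_eq0 IHk; last by lia.
by case: (odd t) tE => /= tE; lia.
Qed.

Lemma bits_gt0 k t : t < 2 ^ k -> (true \in bits k t) = (0 < t).
Proof.
elim: k t => [|k IHk] t; first by case: t.
rewrite expnS => lt_t; have tE := odd_double_half t.
rewrite /= inE IHk; last by lia.
by case: (odd t) tE => /= tE; lia.
Qed.

Lemma eq_mod_sum N a b t : a < N -> b < N -> t < N ->
  (a + b == t %[mod N]) = (a + b == t) || (a + b == t + N).
Proof.
move=> lt_a lt_b lt_t; rewrite [t %% N]modn_small //.
case: (ltnP (a + b) N) => [lt_ab|le_ab]; first by rewrite modn_small //; lia.
by rewrite -{1}(subnK le_ab) modnDr modn_small; lia.
Qed.

Lemma sum_ord_pred (V : nmodType) n (F : nat -> V) : 0 < n ->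
  (\sum_(a < n) F a = \sum_(a < n - 1) F a + F (n - 1)%N)%R.
Proof. by case: n => // n _; rewrite big_ord_recr subSS subn0. Qed.

(** On the diagonal, [a + b + c = t + 2 ^ k * c] says that [a + b] is [t] or [t + (2 ^ k - 1)],
    which is the congruence. *)
Lemma lowsum_card k t : t < 2 ^ k - 1 ->
  (lowsum (bits k t) = #|Stk t k|%:R)%R.
Proof.
move=> lt_t; have k_gt0 : 0 < 2 ^ k by rewrite expn_gt0.
pose w a := count_mem true (bits k a).
pose F a b := ((a + b == t) || (a + b == t + (2 ^ k - 1))) && (w a + w b < k).
(* The matrix sums over [a, b < 2 ^ k]; the extra value [2 ^ k - 1] has weight [k] and is excluded
   by the weight condition. *)
have wN : w (2 ^ k - 1) = k.
  have := @bits_full k (2 ^ k - 1); rewrite eqxx ltn_subrL k_gt0 => /(_ isT)/eqP f0.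
  by have := count_false_true (bits k (2 ^ k - 1)); rewrite size_bits f0.
have -> : (lowsum (bits k t) = \sum_(a < 2 ^ k) \sum_(b < 2 ^ k) (F a b)%:R)%R.
  rewrite /lowsum size_bits /ctrace !cpoly_bits; [|lia|lia].
  under eq_bigr do rewrite -big_split coef_sum.
  rewrite exchange_big; apply: eq_bigr => a _ /=.
  under eq_bigr do rewrite -big_split coef_sum.
  rewrite exchange_big; apply: eq_bigr => b _ /=.
  under eq_bigr do rewrite -mulrDl -natrD mulr_natl coefMn -mulr_natl.
  rewrite -big_distrr sum_coefXn /= -natrM -/(w a) -/(w b) /F; congr (_%:R)%R.
  by case: (_ < k); rewrite ?andbF ?andbT ?muln0 ?muln1 //; lia.
have -> : #|Stk t k| = \sum_(a < 2 ^ k - 1) \sum_(b < 2 ^ k - 1) F a b.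
  rewrite (pair_bigA _ (fun a b : 'I_(2 ^ k - 1) => F a b : nat)).
  rewrite -sum1_card big_mkcond; apply: eq_bigr => -[a b] _.
  rewrite inE /= eq_mod_sum // /F !(@wt_bits k); first by case: (_ && _).
  - exact: leq_trans (ltn_ord b) (leq_subr _ _).
  - exact: leq_trans (ltn_ord a) (leq_subr _ _).
rewrite (sum_ord_pred (fun a => \sum_(b < 2 ^ k) (F a b)%:R)%R) //.
rewrite [X in (_ + X)%R]big1 ?addr0; last first.
  by move=> b _; rewrite /F wN ltnNge leq_addr andbF.
rewrite natr_sum; apply: eq_bigr => a _.
rewrite natr_sum (sum_ord_pred (fun b => (F a b)%:R)%R) // /F wN.
by rewrite [_ < k]ltnNge leq_addl andbF addr0.
Qed.

(** * Counting the extremal words *)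

Lemma wsum_blocks n r e z :
  wsum n (fun s => blocks r e s && (count_mem false s == z) : nat) =
  if e <= n then 'C(n - e - z * r, z) else 0.
Proof.
elim: n e z => [|n IHn] e z; first by case: e z => [|e] [|z].
rewrite wsumS; case: e => [|e] /=; last first.
  under eq_wsum do rewrite add0n; rewrite IHn ltnS subSS.
  by rewrite (wsum0 nat n) addn0.
under eq_wsum do rewrite add0n; rewrite IHn leq0n !subn0.
case: z => [|z] /=.
  under eq_wsum do rewrite add1n andbF.
  by rewrite (wsum0 nat n) !bin0.
under eq_wsum do rewrite add1n eqSS.
rewrite IHn -subnDA -mulSn.
(* Splitting on the first letter gives Pascal's rule. If the prescribed ones exceed [n], both
   subtractions truncate to 0 and both sides vanish, for [z = 0] because the test [r <= n] fails. *)
case: (leqP (z.+1 * r) n) => [le_n|lt_n].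
  by rewrite subSn // binS ifT //; apply: leq_trans le_n; rewrite leq_pmull.
have -> : n - z.+1 * r = 0 by lia.
have -> : n.+1 - z.+1 * r = 0 by lia.
by case: ifP => // le_r; case: z lt_n => //; rewrite mul1n ltnNge le_r.
Qed.

Definition good (k Z : nat) (w : seq bool) : bool :=
  [&& true \in w, (lowsum w == 2 ^+ (k - 1))%R & count_mem false w == Z].

Lemma zeros_bits k t : zeros k t = count_mem false (bits k t).
Proof. by rewrite /zeros word_bits. Qed.

Lemma EZ_wsum k Z : 0 < Z -> EZ k Z = wsum k (fun w => good k Z w : nat).
Proof.
move=> Z_gt0; have k_gt0 : 0 < 2 ^ k by rewrite expn_gt0.
rewrite -sum_bits /EZ -sum1_card big_mkcond /=.
rewrite (sum_ord_pred (fun t => good k Z (bits k t) : nat)) //.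
(* The word of [2 ^ k - 1] has no zeros, whereas [Z] is positive. *)
have -> : good k Z (bits k (2 ^ k - 1)) = false.
  have := @bits_full k (2 ^ k - 1).
  rewrite /good eqxx ltn_subrL k_gt0 => /(_ isT)/eqP->.
  by rewrite [0 == Z]ltn_eqF // !andbF.
rewrite addr0; apply: eq_bigr => t _.
have lt_t : t < 2 ^ k by apply: leq_trans (ltn_ord t) (leq_subr _ _).
rewrite !inE zeros_bits /good bits_gt0 // lowsum_card // -natrX eqr_nat -andbA.
by case: [&& _, _ & _].
Qed.

Lemma good_rot k Z n w : good k Z (rot n w) = good k Z w.
Proof.
rewrite /good mem_rot lowsum_rot; congr [&& _, _ & _ == _].
by apply/permP; rewrite perm_rot.
Qed.

(** The leading zero opens a block as well, so the initial requirement of [blocks] is also [r], that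
    is [Z - 1]. *)
Lemma good_cons k r q : size q = k.+1 ->
  good k.+2 r.+1 (false :: q) = blocks r r q && (count_mem false q == r).
Proof.
move=> sq; rewrite /good inE /= add1n eqSS subSS subn0 -sq.
case: (count_mem false q =P r) => [c0|]; rewrite ?andbF ?andbT //=.
case: (boolP (true \in q)) => [tq|ntq] /=; first by rewrite lowsum_blocks ?c0 ?eqxx.
apply/esym/negP => /blocks_count; have := count_false_true q.
by move: ntq; rewrite -has_pred1 has_count -eqn0Ngt => /eqP->; lia.
Qed.

(* Each good word of length k is counted once for each rotation that brings
   one of its Z zeros to the front. *)
Lemma EZ_mul k r : r.+1 * EZ k.+2 r.+1 =
  k.+2 * (if r <= k.+1 then 'C(k.+1 - r - r * r, r) else 0).
Proof.
rewrite EZ_wsum // -wsumMl.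
transitivity (wsum k.+2 (fun w => \sum_(j < k.+2)
    ~~ nth true w j * good k.+2 r.+1 w)).
  apply: eq_wsum => w sw; rewrite -big_distrl /=.
  case: (boolP (good _ _ w)) => [/and3P[_ _ /eqP<-]|_]; last by rewrite !muln0.
  congr (_ * _).
  rewrite -[RHS]/(\sum_(j < k.+2) (fun j => ~~ nth true w j : nat) j).
  rewrite -sw -(big_mkord xpredT (fun j => ~~ nth true w j : nat)).
  rewrite -(big_nth true xpredT (fun b => ~~ b : nat)).
  by elim: (w) => [|b v IHv]; rewrite ?big_nil // big_cons /= IHv; case: b.
pose G w := ~~ nth true w 0 * good k.+2 r.+1 w.
transitivity (\sum_(j < k.+2) wsum k.+2 G); last first.
  rewrite sum_nat_const card_ord wsumS.
  have -> : wsum k.+1 (fun u => G (true :: u)) = 0.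
    by rewrite -[RHS](@wsum0 nat k.+1); apply: eq_wsum => u _; rewrite /G mul0n.
  rewrite add0n -wsum_blocks.
  by congr (_ * _); apply: eq_wsum => q sq; rewrite /G mul1n good_cons.
rewrite -wsum_sum; apply: eq_bigr => j _.
rewrite -(@wsum_rot _ _ j G) ?(ltnW (ltn_ord j)) //; apply: eq_wsum => w sw.
by rewrite /G good_rot /rot nth_cat size_drop subn_gt0 sw ltn_ord nth_drop addn0.
Qed.

(** * The closed formulas *)

Unset Implicit Arguments.
(* The subtractions below do not truncate when 1 <= Z and Z ^ 2 <= k. *)
Theorem corollary7p5 (k : nat) (hk : 2 <= k) :
  [/\ forall Z : nat, 1 <= Z <= Nat.sqrt k ->
        ((EZ k Z)%:R = k%:R / Z%:R * 'C(k - Z ^ 2 + Z - 1, Z - 1)%:R :> rat)%R,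
      forall Z : nat, k < Z ^ 2 -> EZ k Z = 0
    & ((E k)%:R = \sum_(1 <= Z < (Nat.sqrt k).+1)
         k%:R / Z%:R * 'C(k - Z ^ 2 + Z - 1, Z - 1)%:R :> rat)%R].
Proof.
have sqrt_le Z : (Z <= Nat.sqrt k) = (Z ^ 2 <= k).
  have := PeanoNat.Nat.sqrt_spec k (PeanoNat.Nat.le_0_l k); rewrite -mulnn.
  by move: (Nat.sqrt k) => s; nia.
have formula Z : 1 <= Z <= Nat.sqrt k ->
    ((EZ k Z)%:R = k%:R / Z%:R * 'C(k - Z ^ 2 + Z - 1, Z - 1)%:R :> rat)%R.
  case: Z => // r; rewrite sqrt_le => /andP[_ le_k].
  case: k {sqrt_le} hk le_k => [|[|m]] // _ le_m.
  have := EZ_mul m r; rewrite ifT; last by nia.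
  have -> : m.+1 - r - r * r = m.+2 - r.+1 ^ 2 + r.+1 - 1 by nia.
  rewrite [_ - 1]subn1 [r.+1 - 1]subn1 => /(congr1 (fun n => n%:R : rat)%R).
  rewrite !natrM => eqEZ; rewrite mulrAC -eqEZ mulrC mulKf //.
  by rewrite pnatr_eq0.
have vanish Z : k < Z ^ 2 -> EZ k Z = 0.
  case: Z => // r; case: k {sqrt_le formula} hk => [|[|m]] // _ lt_m.
  apply/eqP; rewrite -(eqn_pmul2l (ltn0Sn r)) EZ_mul muln0.
  case: ifP => le_r; last by rewrite muln0.
  (* From [k < (r + 1) ^ 2] the upper index [k - 1 - r - r ^ 2] is less than [r]. *)
  by rewrite bin_small ?muln0 //; nia.
split=> //.
have EZ0 : EZ k 0 = 0.
  apply: eq_card0 => t; rewrite !inE zeros_bits.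
  rewrite bits_full; last by apply: leq_trans (ltn_ord t) (leq_subr _ _).
  by rewrite (ltn_eqF (ltn_ord t)) andbF.
have -> : E k = \sum_(Z < k.+1) EZ k Z.
  rewrite /E -sum1_card.
  rewrite (partition_big (fun t : 'I_(2 ^ k - 1) => inord (zeros k t) : 'I_k.+1) predT) //=.
  apply: eq_bigr => Z _; rewrite sum1_card; apply: eq_card => t.
  rewrite [RHS]inE; congr (_ && _); rewrite -val_eqE /= inordK // ltnS.
  by rewrite zeros_bits -[X in _ <= X](size_bits k t) seq.count_size.
rewrite -(big_mkord xpredT (EZ k)) big_ltn // EZ0 add0n.
(* Beyond the integer square root of [k] every term vanishes. *)
rewrite (@big_cat_nat _ _ _ (Nat.sqrt k).+1) //=; last first.
  by have := sqrt_le (Nat.sqrt k); rewrite leqnn; nia.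
rewrite [X in _ + X]big_nat_cond [X in _ + X]big1 ?addn0; last first.
  move=> Z /andP[/andP[lt_Z _] _]; apply: vanish.
  by rewrite ltnNge -sqrt_le -ltnNge.
by rewrite natr_sum; apply: eq_big_nat => Z; rewrite ltnS => /formula.
Qed.
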